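(* The theory of the structure $\langle\mathbb Q^+;\times,\mathbf 1,{}^{-1},\Re_2,\Re_3,\dots\rangle$ admits quantifier elimination.
   Context: $\mathbb Q^+$ is the set of positive rational numbers, $\times$ is multiplication and ${}^{-1}$ is the multiplicative inverse. For $n\ge 2$, $\Re_n$ is the unary relation of being the $n$th power of a rational number: $\Re_n(x)$ holds if and only if there is $y\in\mathbb Q$ with $x=y^n$. Quantifier elimination means that every formula of the language $\{\times,\mathbf 1,{}^{-1},\Re_2,\Re_3,\dots\}$ is equivalent in the structure to a quantifier-free formula of that language. *)

(* Defs.v *)
From mathcomp Require Import all_boot all_order all_algebra.

Set Implicit Arguments.
Unset Strict Implicit.
Unset Printing Implicit Defensive.

Import Order.TTheory GRing.Theory Num.Theory.
Local Open Scope ring_scope.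

Definition Qpos := {x : rat | 0 < x}.

Definition Qpos_one : Qpos := exist _ 1 ltr01.

Definition Qpos_mul (x y : Qpos) : Qpos :=
  exist _ (val x * val y) (mulr_gt0 (valP x) (valP y)).

Lemma Qpos_inv_subproof (x : Qpos) : 0 < (val x)^-1.
Proof. by rewrite invr_gt0; exact: (valP x). Qed.

Definition Qpos_inv (x : Qpos) : Qpos := exist _ (val x)^-1 (Qpos_inv_subproof x).

(* The root is sought in all of rat, so it may be negative. *)
Definition is_nth_power (n : nat) (x : Qpos) : Prop :=
  exists y : rat, val x = y ^+ n.

Inductive term : Type :=
| TVar of nat
| TOne
| TMul of term & term
| TInv of term.

(* First-order logic with equality; there is one unary symbol FPow n for each
   n >= 2, and no other nonlogical relation symbol. *)
Inductive formula : Type :=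
| FFalse
| FEq of term & term
| FPow (n : nat) of (1 < n)%N & term
| FNot of formula
| FAnd of formula & formula
| FOr of formula & formula
| FImp of formula & formula
| FForall of nat & formula
| FExists of nat & formula.

Fixpoint quantifier_free (f : formula) : bool :=
  match f with
  | FFalse | FEq _ _ | FPow _ _ _ => true
  | FNot g => quantifier_free g
  | FAnd g h | FOr g h | FImp g h => quantifier_free g && quantifier_free h
  | FForall _ _ | FExists _ _ => false
  end.

Definition update (e : nat -> Qpos) (i : nat) (x : Qpos) : nat -> Qpos :=
  fun j => if j == i then x else e j.

Fixpoint eval (e : nat -> Qpos) (t : term) : Qpos :=
  match t with
  | TVar i => e i
  | TOne => Qpos_one
  | TMul s u => Qpos_mul (eval e s) (eval e u)
  | TInv s => Qpos_inv (eval e s)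
  end.

Fixpoint holds (e : nat -> Qpos) (f : formula) : Prop :=
  match f with
  | FFalse => False
  | FEq s t => eval e s = eval e t
  | FPow n _ t => is_nth_power n (eval e t)
  | FNot g => ~ holds e g
  | FAnd g h => holds e g /\ holds e h
  | FOr g h => holds e g \/ holds e h
  | FImp g h => holds e g -> holds e h
  | FForall i g => forall x : Qpos, holds (update e i x) g
  | FExists i g => exists x : Qpos, holds (update e i x) g
  end.

Definition equivalent (f g : formula) : Prop :=
  forall e : nat -> Qpos, holds e f <-> holds e g.

(* Main.v *)
Require Import Defs.
From HB Require Import structures.
From mathcomp Require Import all_boot all_order all_algebra.
From mathcomp Require Import boolp.
From mathcomp Require Import zify.

Set Implicit Arguments.
Unset Strict Implicit.
Unset Printing Implicit Defensive.

Import Order.TTheory GRing.Theory Num.Theory.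
Local Open Scope ring_scope.

(** Unique factorization makes Q+ a free abelian group on the primes. It is
written additively here, so that x ^ n becomes x *+ n and being an nth power
becomes being divisible by n. Two features of this group suffice for quantifier
elimination: it is torsion-free, and any finite set of elements lies in the
kernel of a homomorphism v to the integers with v g = 1 for some g, namely the
valuation at a prime occurring in none of them ([fresh_coordinate]).

The argument is a back-and-forth with bounds. Fix k variables and write lc e a
for the integer combination of e 0, ..., e (k - 1) with coefficients a. Say that
e and e' agree up to (N, M) when the same combinations with coefficients of size
at most N vanish, and the same combinations are divisible by M. Agreement up to
(N, M) is decided by finitely many atomic formulas, because divisibility by M
depends on the coefficients modulo M only.

The core is [agree_extend]: if e and e' agree up to some bound computed from
(N, M), every value x of the variable i on the side of e has a counterpart x' on
the side of e' such that the updated assignments agree up to (N, M).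
- If x satisfies a relation c x + (combination of the others) = 0 with
  coefficients at most N and c <> 0, then divisibility by c provides x' with the
  same relation; multiplying by c turns every question about x into one about
  the other variables.
- Otherwise, the coefficients of x in the combinations divisible by M form a
  subgroup of the integers, generated by a divisor d0 of M. One of these
  combinations is d0 x + r, with r free of x; then d0 divides r, hence also the
  counterpart r' of r on the side of e', say r' = - d0 h. Put
  x' = h + (M / d0) g for a fresh g. Then d0 x' + r' = M g is divisible by M, and
  the presence of g lets no coefficient outside d0 Z occur for x' and makes x'
  independent of the other variables.

By induction, every formula is determined by agreement up to some bound
([formula_determined]), and a property determined by the truth values of
finitely many quantifier-free formulas is a Boolean combination of them
([qf_of_determined]). *)

(** * Q+ as an additive group *)

HB.instance Definition _ := Choice.copy Qpos {x : rat | 0 < x}.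

Lemma Qpos_mulA : associative Qpos_mul.
Proof. by move=> x y z; apply: val_inj; rewrite /= mulrA. Qed.
Lemma Qpos_mulC : commutative Qpos_mul.
Proof. by move=> x y; apply: val_inj; rewrite /= mulrC. Qed.
Lemma Qpos_mul1 : left_id Qpos_one Qpos_mul.
Proof. by move=> x; apply: val_inj; rewrite /= mul1r. Qed.
Lemma Qpos_mulV : left_inverse Qpos_one Qpos_inv Qpos_mul.
Proof.
by move=> x; apply: val_inj; rewrite /= mulVf // gt_eqF //; exact: (valP x).
Qed.

HB.instance Definition _ :=
  GRing.isZmodule.Build Qpos Qpos_mulA Qpos_mulC Qpos_mul1 Qpos_mulV.

Lemma val_mulrn (x : Qpos) n : val (x *+ n) = val x ^+ n.
Proof. by elim: n => [|n IHn]; rewrite ?mulr0n // mulrS exprS -IHn. Qed.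

(** * Torsion-freeness and divisibility *)

Definition divisible (n : nat) (x : Qpos) : Prop := exists y : Qpos, x = y *+ n.

(** A rational nth root of a positive number can be replaced by its absolute
value, so roots may be sought in Q+. *)
Lemma is_nth_powerE n (x : Qpos) :
  (0 < n)%N -> is_nth_power n x <-> divisible n x.
Proof.
move=> n0; split=> [[y xy]|[y ->]]; last by exists (val y); rewrite val_mulrn.
have y0 : 0 < `|y|.
  rewrite normr_gt0; apply/eqP => y0.
  by have := valP x; rewrite xy y0 expr0n eqn0Ngt n0 ltxx.
exists (exist _ `|y| y0); apply: val_inj; rewrite val_mulrn /= -normrX -xy.
by rewrite gtr0_norm //; exact: (valP x).
Qed.

Lemma Qpos_torsion_free (x : Qpos) n : (0 < n)%N -> x *+ n = 0 -> x = 0.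
Proof.
move=> n0 /(congr1 val); rewrite val_mulrn => /eqP.
rewrite pexpr_eq1 //; last exact/ltW/(valP x).
by move=> /eqP x1; apply: val_inj.
Qed.

Lemma Qpos_mulIz (c : int) : c != 0 -> injective (fun x : Qpos => x *~ c).
Proof.
move=> c0 x y /= /eqP; rewrite -subr_eq0 -mulrzBl => /eqP xyc.
apply/eqP; rewrite -subr_eq0; apply/eqP; move: xyc.
case: (intP c) c0 => // n _; last rewrite mulrNz => /eqP; rewrite ?oppr_eq0.
  exact: Qpos_torsion_free.
by move=> /eqP; exact: Qpos_torsion_free.
Qed.

Lemma Qpos_mulz_eq0 (x : Qpos) (c : int) : c != 0 -> x *~ c = 0 <-> x = 0.
Proof.
move=> c0; split=> [xc|->]; last by rewrite mul0rz.
by apply: (Qpos_mulIz c0); rewrite xc mul0rz.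
Qed.

Section Divisibility.
Implicit Types (n : nat) (x y : Qpos).

Lemma divisibleD n x y : divisible n x -> divisible n y -> divisible n (x + y).
Proof. by move=> [x' ->] [y' ->]; exists (x' + y'); rewrite mulrnDl. Qed.

Lemma divisibleN n x : divisible n x -> divisible n (- x).
Proof. by move=> [x' ->]; exists (- x'); rewrite mulNrn. Qed.

Lemma divisibleMz n x (c : int) : divisible n x -> divisible n (x *~ c).
Proof. by move=> [y ->]; exists (y *~ c); rewrite !pmulrn mulrzAC. Qed.

Lemma divisibleBl n x y : divisible n y -> divisible n (x - y) <-> divisible n x.
Proof.
move=> ny; split=> [nxy|nx]; last exact/divisibleD/divisibleN.
by rewrite -(subrK y x); exact: divisibleD.
Qed.

Lemma divisible_absz (c : int) x :
  divisible `|c| x <-> exists y : Qpos, x = y *~ c.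
Proof.
case: (intP c) => [|n|n]; rewrite ?abszN; try by [].
by split=> -[y ->]; exists (- y); rewrite mulrNz -mulNrz ?opprK.
Qed.

(** Multiplication by c is injective, hence reflects divisibility. This trades
divisibility of x for divisibility of c x, which may no longer involve a given
variable. *)
Lemma divisible_mul n (c : int) x :
  c != 0 -> divisible (n * `|c|) (x *~ c) <-> divisible n x.
Proof.
move=> c0; have -> : (n * `|c| = `|(n%:Z * c)%R|)%N by rewrite abszM.
rewrite divisible_absz; split=> [[y]|[y ->]]; last first.
  by exists y; rewrite mulrzA.
by rewrite mulrzA => /(Qpos_mulIz c0) ->; exists y.
Qed.

Lemma divisible_dvd d n x : (d %| n)%N -> divisible n x -> divisible d x.
Proof. by move=> /dvdnP[q ->] [y ->]; exists (y *+ q); rewrite mulrnA. Qed.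

End Divisibility.

(** * Fresh primes *)

Definition padic_val (p : nat) (x : Qpos) : int :=
  (logn p `|numq (val x)|%N)%:Z - (logn p `|denq (val x)|%N)%:Z.

(** The fraction need not be reduced, which is what makes the valuation of a
quotient computable. *)
Lemma padic_val_frac p (x : Qpos) (a b : nat) : (0 < a)%N -> (0 < b)%N ->
  val x = a%:R / b%:R -> padic_val p x = (logn p a)%:Z - (logn p b)%:Z.
Proof.
move=> a0 b0 xab; have x0 := valP x; rewrite /= in x0.
have n0 : (0 < `|numq (val x)|)%N by rewrite absz_gt0 numq_eq0 gt_eqF.
have d0 : (0 < `|denq (val x)|)%N by rewrite absz_gt0 denq_neq0.
have : (a * `|denq (val x)| = `|numq (val x)| * b)%N.
  apply/eqP; rewrite -(eqr_nat rat) !natrM !natr_absz.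
  rewrite !gtr0_norm ?numq_gt0 ?denq_gt0 // numqE {2}xab; apply/eqP.
  have b1 : b%:R != 0 :> rat by rewrite pnatr_eq0 -lt0n.
  by rewrite mulrAC divfK.
move=> /(congr1 (logn p)); rewrite !lognM // /padic_val; lia.
Qed.

Lemma padic_val_is_additive p : zmod_morphism (padic_val p).
Proof.
move=> x y; have x0 : 0 < val x := valP x; have y0 : 0 < val y := valP y.
have nx : (0 < `|numq (val x)|)%N by rewrite absz_gt0 numq_eq0 gt_eqF.
have dx : (0 < `|denq (val x)|)%N by rewrite absz_gt0 denq_neq0.
have ny : (0 < `|numq (val y)|)%N by rewrite absz_gt0 numq_eq0 gt_eqF.
have dy : (0 < `|denq (val y)|)%N by rewrite absz_gt0 denq_neq0.
rewrite (@padic_val_frac p (x - y) (`|numq (val x)| * `|denq (val y)|)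
  (`|denq (val x)| * `|numq (val y)|)) ?muln_gt0 ?nx ?dx ?ny ?dy //.
  by rewrite !lognM // /padic_val; lia.
rewrite !natrM !natr_absz !gtr0_norm ?numq_gt0 ?denq_gt0 //.
rewrite -[LHS]/(val x / val y) -{1}(divq_num_den (val x)).
by rewrite -{1}(divq_num_den (val y)) invf_div mulf_div.
Qed.

HB.instance Definition _ p :=
  GRing.isZmodMorphism.Build Qpos int (padic_val p) (padic_val_is_additive p).

(** A prime exceeding all numerators and denominators in s divides none of
them. This is how the infinitude of primes enters. *)
Lemma fresh_coordinate (s : seq Qpos) :
  exists (v : {additive Qpos -> int}) (g : Qpos),
    v g = 1 /\ {in s, forall x, v x = 0}.
Proof.
pose m (x : Qpos) := maxn `|numq (val x)| `|denq (val x)|.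
have [p pm pp] := prime_above (\max_(x <- s) m x).
have p0 : 0 < p%:R :> rat by rewrite ltr0n prime_gt0.
exists (padic_val p : {additive _ -> _}), (exist _ p%:R p0); split=> [|x xs] /=.
  have pfrac : p%:R = p%:R / 1%:R :> rat by rewrite divr1.
  rewrite (@padic_val_frac p (exist _ p%:R p0) p 1 (prime_gt0 pp) isT pfrac) logn1.
  by rewrite -{2}(expn1 p) pfactorK.
have mx : (m x < p)%N by apply: leq_ltn_trans pm; exact: leq_bigmax_seq.
have := mx; rewrite gtn_max => /andP[nx dx].
have logn_small n : (n < p)%N -> logn p n = 0%N.
  by case: n => [|n] np; rewrite ?logn0 // lognE pp /= gtnNdvd.
by rewrite /padic_val !logn_small.
Qed.

(** * Agreement of assignments and its extension *)

Section LinearCombinations.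
Context (k : nat).
Implicit Types (e : nat -> Qpos) (a b : 'I_k -> int) (x : Qpos).

Definition lc e a : Qpos := \sum_(j < k) e j *~ a j.

Lemma eq_lc e a b : a =1 b -> lc e a = lc e b.
Proof. by move=> ab; apply: eq_bigr => j _; rewrite ab. Qed.

Lemma lcB e a b c d :
  lc e (fun j => c * a j - d * b j) = lc e a *~ c - lc e b *~ d.
Proof.
rewrite /lc mulrz_suml mulrz_suml -sumrB; apply: eq_bigr => j _.
by rewrite mulrzBr [c * _]mulrC [d * _]mulrC !mulrzA.
Qed.

Lemma lc_update e (i : 'I_k) x a :
  lc (update e i x) a = x *~ a i + \sum_(j < k | j != i) e j *~ a j.
Proof.
rewrite /lc (bigD1 i) //= {1}/update eqxx; congr (_ + _).
by apply: eq_bigr => j ji; rewrite /update (inj_eq val_inj) (negPf ji).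
Qed.

Lemma lc_update0 e (i : 'I_k) x a : a i = 0 -> lc (update e i x) a = lc e a.
Proof.
by move=> ai; rewrite lc_update /lc [RHS](bigD1 i) //= ai !mulr0z.
Qed.

Definition omit (i : 'I_k) a : 'I_k -> int := fun j => if j == i then 0 else a j.

Lemma lc_update_omit e (i : 'I_k) x a :
  lc (update e i x) a = x *~ a i + lc e (omit i a).
Proof.
rewrite lc_update -[lc e _](@lc_update0 e i 0) /omit ?eqxx // lc_update.
by rewrite mul0rz add0r; congr (_ + _); apply: eq_bigr => j /negPf ->.
Qed.

Definition bounded N a := forall j, (`|a j| <= N)%N.

Definition agree N M (e e' : nat -> Qpos) :=
  (forall a, bounded N a -> lc e a = 0 <-> lc e' a = 0) /\
  (forall a, divisible M (lc e a) <-> divisible M (lc e' a)).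

Lemma agree_sym N M e e' : agree N M e e' -> agree N M e' e.
Proof.
by case=> eqs divs; split=> a; [move=> /eqs | have := divs a]; move=> [].
Qed.

(** For the modulus: with M' = q M, divisibility of a combination by M is
divisibility of its q-fold multiple by M', again a combination. *)
Lemma agree_sub N N' M M' e e' : (0 < M')%N -> (N <= N')%N -> (M %| M')%N ->
  agree N' M' e e' -> agree N M e e'.
Proof.
move=> M'0 NN' /dvdnP[q MM'] [eqs divs]; split=> [a aN|a].
  by apply: eqs => j; apply: leq_trans NN'.
have q0 : q%:Z != 0 by case: (q) MM' M'0 => // ->.
have E e0 : divisible M (lc e0 a) <-> divisible M' (lc e0 (fun j => q%:Z * a j - 0 * a j)).
  by rewrite lcB mulr0z subr0 MM' mulnC (divisible_mul M _ q0).
by rewrite !E.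
Qed.

(** A relation satisfied by x eliminates x: subtracting a multiple of the
relation from a multiple of any other combination cancels x. *)
Lemma lc_relation e (i : 'I_k) x a0 a : lc (update e i x) a0 = 0 ->
  lc (update e i x) a *~ a0 i = lc e (fun j => a0 i * a j - a i * a0 j).
Proof.
by move=> r0; rewrite -(@lc_update0 e i x) ?lcB ?r0 ?mul0rz ?subr0 // mulrC subrr.
Qed.

(** The same elimination modulo M, for a combination in which the coefficient of
x is a multiple of its coefficient in a combination known to be divisible. The
factor 1 puts the coefficients in the form expected by [lcB]. *)
Lemma divisible_lc_update M e (i : 'I_k) x a0 a q :
    divisible M (lc (update e i x) a0) -> a i = q * a0 i ->
  divisible M (lc (update e i x) a) <->
  divisible M (lc e (fun j => 1 * a j - q * a0 j)).
Proof.
move=> d0 aq; rewrite -(@lc_update0 e i x) ?lcB ?mulr1z; last first.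
  by rewrite mul1r aq subrr.
by rewrite divisibleBl //; exact: divisibleMz.
Qed.

(** Eliminating x by a relation with coefficients at most N yields combinations
with coefficients at most 2 N N, and multiplies moduli by the coefficient of x in
that relation, which divides N!. *)
Lemma extend_algebraic N M e e' (i : 'I_k) x a0 : (0 < M)%N ->
    agree (2 * N * N) (M * N`!) e e' -> bounded N a0 -> a0 i != 0 ->
    lc (update e i x) a0 = 0 ->
  exists x', agree N M (update e i x) (update e' i x').
Proof.
move=> M0 ee' a0N a0i r0; set c := a0 i in a0i.
have c0 : (0 < `|c|)%N by rewrite absz_gt0.
have cN : (`|c| %| N`!)%N by rewrite dvdn_fact // c0 a0N.
have Mc0 : (0 < M * N`!)%N by rewrite muln_gt0 M0 fact_gt0.
have [_ divc] : agree 0 `|c| e e'.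
  by apply: agree_sub ee' => //; rewrite dvdn_mull.
have [_ divMc] : agree 0 (M * `|c|) e e'.
  by apply: agree_sub ee' => //; rewrite dvdn_mul.
(* As e and e' agree on divisibility by c, the c-th root can be taken. *)
have [y yb] : exists y : Qpos, lc e' (omit i a0) = y *~ c.
  apply/divisible_absz/divc/divisible_absz; exists (- x).
  by apply/eqP; rewrite mulNrz -addr_eq0 addrC -lc_update_omit r0.
have r0' : lc (update e' i (- y)) a0 = 0 by rewrite lc_update_omit yb mulNrz addNr.
exists (- y); split=> a.
  move=> aN; have E x1 := Qpos_mulz_eq0 x1 a0i.
  apply: (iff_trans (iff_sym (E _))); apply: iff_trans (E _).
  rewrite /c !lc_relation //.
  case: ee' => eqs _; apply: eqs => j.
  have := leq_mul (a0N i) (aN j); have := leq_mul (aN i) (a0N j).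
  by rewrite -!abszM; lia.
have E x1 := divisible_mul M x1 a0i.
apply: (iff_trans (iff_sym (E _))); apply: iff_trans (E _).
by rewrite /c !lc_relation.
Qed.

(** The free case: x' is the sum of an element imitating the behaviour of x
modulo M and of a multiple of a fresh generator, which prevents both relations
and unwanted divisibilities. *)
Lemma extend_transcendental N M e e' (i : 'I_k) x : (0 < M)%N ->
    agree N M e e' ->
    (forall a, bounded N a -> a i != 0 -> lc (update e i x) a <> 0) ->
  exists x', agree N M (update e i x) (update e' i x').
Proof.
move=> M0 ee' free; have [eqs divs] := ee'; set u := update e i x.
(* d0 is the least positive coefficient of x in a combination divisible by M; by
   Euclidean division it generates all such coefficients. *)
pose occurs d := `[< (0 < d)%N /\ exists a, a i = d%:Z /\ divisible M (lc u a) >].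
have occursM : exists d, occurs d.
  exists M; apply/asboolP; split=> //; exists (fun=> M%:Z); split=> //.
  by rewrite /lc; exists (\sum_(j < k) u j); rewrite pmulrn mulrz_suml.
case: (ex_minnP occursM) => d0 /asboolP[d00 [a0 [a0i diva0]]] d0min.
have d0z : d0%:Z != 0 by lia.
have d0dvd a : divisible M (lc u a) -> exists q, a i = q * a0 i.
  move=> diva; exists (a i %/ a0 i)%Z; rewrite a0i.
  have /eqP r0 : (a i %% d0%:Z == 0)%Z.
    apply: contraT => r0.
    have /d0min : occurs `|(a i %% d0%:Z)%Z|%N.
      apply/asboolP; rewrite absz_gt0; split=> //.
      exists (fun j => 1 * a j - (a i %/ d0%:Z)%Z * a0 j); split.
        by rewrite a0i mul1r gez0_abs ?modz_ge0 ?gt_eqF //; lia.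
      by rewrite lcB mulr1z; apply/divisibleBl => //; exact: divisibleMz.
    by have := @modz_ge0 (a i) d0%:Z d0z; have := @ltz_pmod (a i) d0%:Z d00; lia.
  by have := divz_eq (a i) d0%:Z; lia.
(* The combination with all coefficients equal to M is divisible by M, so d0
   divides M. *)
have [m Mm] : exists m, M = (m * d0)%N.
  have [|q] := d0dvd (fun=> M%:Z).
    by exists (\sum_(j < k) u j); rewrite /lc pmulrn mulrz_suml.
  rewrite a0i => Mq; exists `|q|%N; lia.
have m0 : (0 < m)%N by move: M0; rewrite Mm muln_gt0 => /andP[].
(* Since d0 divides M, the relation modulo M for x makes the part without x
   divisible by d0, on the side of e and hence on the side of e'. *)
have [y yb] : exists y : Qpos, lc e' (omit i a0) = y *+ d0.
  have d0M : (d0 %| M)%N by rewrite Mm dvdn_mull.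
  have [_ divd0] : agree 0 d0 e e' by exact: agree_sub ee'.
  apply/divd0; have := divisible_dvd d0M diva0.
  rewrite lc_update_omit a0i addrC -{1}[x *~ _]opprK.
  by move/divisibleBl; apply; apply: divisibleN; exists x.
have [v [g [vg v0]]] := fresh_coordinate (- y :: [seq e' j | j <- iota 0 k]).
exists (- y + g *+ m); set u' := update _ _ _.
(* The coordinate v sees nothing but the coefficient of x'. *)
have vu' a : v (lc u' a) = m%:Z * a i.
  rewrite lc_update raddfD raddf_sum big1 => [|j _].
    rewrite addr0 raddfMz raddfD raddfMn vg v0 ?mem_head // add0r mulrzz.
    by congr (_ * _); lia.
  rewrite raddfMz v0 ?mul0rz // in_cons map_f ?orbT //.
  by rewrite mem_iota add0n ltn_ord.
have diva0' : divisible M (lc u' a0).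
  rewrite lc_update_omit yb a0i Mm; exists g.
  by rewrite -pmulrn mulrnDl mulNrn addrAC addNr add0r mulrnA.
split=> a.
  move=> aN; case: (eqVneq (a i) 0) => ai.
    by rewrite !lc_update0 //; exact: eqs.
  split=> [/(free _ aN ai)//|/(congr1 v)]; rewrite vu' raddf0 => /eqP.
  by rewrite mulf_eq0 (negPf ai) orbF; lia.
have step q : a i = q * a0 i -> divisible M (lc u a) <-> divisible M (lc u' a).
  by move=> aq; rewrite !(divisible_lc_update _ aq).
split=> diva.
  by have [q aq] := d0dvd _ diva; apply/(step q).
(* Applying v to a combination divisible by M = m d0 gives M | m (a i), that is
   d0 | a i. *)
have [z az] := diva; have := congr1 v az; rewrite vu' raddfMn => vz.
apply/(step (v z)) => //; rewrite a0i.
apply: (@mulfI _ m%:Z); first by rewrite -lt0n.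
by rewrite vz Mm pmulrn mulrzz PoszM mulrCA.
Qed.

Lemma agree_extend N M e e' (i : 'I_k) x : (0 < M)%N ->
    agree (N + 2 * N * N) (M * N`!) e e' ->
  exists x', agree N M (update e i x) (update e' i x').
Proof.
move=> M0 ee'; have M'0 : (0 < M * N`!)%N by rewrite muln_gt0 M0 fact_gt0.
have [[a0 [a0N [a0i r0]]]|free] := pselect (exists a0,
    bounded N a0 /\ a0 i != 0 /\ lc (update e i x) a0 = 0).
  by apply: extend_algebraic a0N a0i r0 => //; apply: agree_sub ee'; rewrite ?leq_addl.
apply: extend_transcendental => //.
  by apply: agree_sub ee'; rewrite ?leq_addr ?dvdn_mulr.
by move=> a aN ai r; apply: free; exists a.
Qed.

End LinearCombinations.

(** * Formulas are determined by agreement *)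

Fixpoint term_below k (t : term) : bool :=
  match t with
  | TVar i => (i < k)%N
  | TOne => true
  | TMul s u => term_below k s && term_below k u
  | TInv s => term_below k s
  end.

(** Bound variables count as well: a quantified variable has to be one of the k
coordinates on which agreement bears, so that [agree_extend] applies to it. *)
Fixpoint formula_below k (f : formula) : bool :=
  match f with
  | FFalse => true
  | FEq s t => term_below k s && term_below k t
  | FPow _ _ t => term_below k t
  | FNot g => formula_below k g
  | FAnd g h | FOr g h | FImp g h => formula_below k g && formula_below k h
  | FForall i g | FExists i g => (i < k)%N && formula_below k g
  end.

Lemma term_below_leq k k' t : (k <= k')%N -> term_below k t -> term_below k' t.
Proof.
move=> kk'; elim: t => //= [i ik|s IHs u IHu /andP[/IHs-> /IHu->]] //.
exact: leq_trans kk'.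
Qed.

Lemma formula_below_leq k k' f :
  (k <= k')%N -> formula_below k f -> formula_below k' f.
Proof.
move=> kk'; have tk t : term_below k t -> term_below k' t by exact: term_below_leq.
elim: f => //= [s t|g IHg h IHh|g IHg h IHh|g IHg h IHh|i g IHg|i g IHg] /andP[].
- by move=> /tk-> /tk->.
- by move=> /IHg-> /IHh->.
- by move=> /IHg-> /IHh->.
- by move=> /IHg-> /IHh->.
- by move=> /leq_trans -> // /IHg->.
- by move=> /leq_trans -> // /IHg->.
Qed.

Lemma term_below_exists t : exists k, term_below k t.
Proof.
elim: t => /= [i|| s [k sk] u [l ul]|]; [by exists i.+1|by exists 0|idtac|by []].
exists (maxn k l).
by rewrite (term_below_leq _ sk) ?leq_maxl // (term_below_leq _ ul) ?leq_maxr.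
Qed.

Lemma formula_below_exists f : exists k, formula_below k f.
Proof.
have join g h : (exists k, formula_below k g) -> (exists k, formula_below k h) ->
    exists k, formula_below k g && formula_below k h.
  move=> [k gk] [l hl]; exists (maxn k l).
  by rewrite (formula_below_leq _ gk) ?leq_maxl // (formula_below_leq _ hl) ?leq_maxr.
have bind i g : (exists k, formula_below k g) ->
    exists k, (i < k)%N && formula_below k g.
  move=> [k gk]; exists (maxn i.+1 k).
  by rewrite leq_maxl (formula_below_leq _ gk) ?leq_maxr.
elim: f => /=; try by auto.
- by exists 0.
- by move=> s t; exact: (term_below_exists (TMul s t)).
- by move=> n _ t; exact: term_below_exists.
Qed.

Fixpoint exponent (t : term) (j : nat) : int :=
  match t with
  | TVar i => (i == j)%:R
  | TOne => 0
  | TMul s u => exponent s j + exponent u j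
  | TInv s => - exponent s j
  end.

Lemma eval_exponent k e t : term_below k t ->
  eval e t = lc e (fun j : 'I_k => exponent t j).
Proof.
rewrite /lc; elim: t => [i ik||s IHs u IHu /andP[/IHs Es /IHu Eu]|s IHs /IHs Es] /=.
- rewrite (bigD1 (Ordinal ik)) //= eqxx big1 ?addr0 // => j ji.
  by rewrite -(inj_eq val_inj) /= eq_sym in ji; rewrite (negPf ji).
- by rewrite big1.
- rewrite -[LHS]/(eval e s + eval e u) Es Eu -big_split.
  by apply: eq_bigr => j _; rewrite mulrzDr.
- rewrite -[LHS]/(- eval e s) Es -sumrN.
  by apply: eq_bigr => j _; rewrite mulrNz.
Qed.

(** The modulus is kept above 1 because the language has a symbol for nth powers
for n > 1 only. *)
Definition determined k (P : (nat -> Qpos) -> Prop) :=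
  exists N M, (1 < M)%N /\
    forall e e', agree k N M e e' -> P e <-> P e'.

(** Quantifiers are handled by [agree_extend]: each value on one side has a
counterpart on the other, and agreement is symmetric. *)
Lemma formula_determined k f : formula_below k f -> determined k (holds^~ f).
Proof.
have join (P Q : (nat -> Qpos) -> Prop) :
    determined k P -> determined k Q ->
  exists N M, (1 < M)%N /\
    forall e e', agree k N M e e' -> (P e <-> P e') /\ (Q e <-> Q e').
  move=> [N [M [M1 PN]]] [N' [M' [M'1 QN]]]; exists (maxn N N'), (M * M')%N.
  have MM' : (0 < M * M')%N by rewrite muln_gt0 (ltnW M1) (ltnW M'1).
  split=> [|e e' ee']; first by rewrite (leq_trans M1) // leq_pmulr // ltnW.
  split.
    by apply: PN; apply: agree_sub ee'; rewrite ?leq_maxl ?dvdn_mulr.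
  by apply: QN; apply: agree_sub ee'; rewrite ?leq_maxr ?dvdn_mull.
have bind (i : 'I_k) (P : (nat -> Qpos) -> Prop) :
    determined k P ->
  exists N M, (1 < M)%N /\ forall e e', agree k N M e e' ->
    forall x, exists x', P (update e i x) <-> P (update e' i x').
  move=> [N [M [M1 PN]]]; exists (N + 2 * N * N)%N, (M * N`!)%N.
  split=> [|e e' ee' x]; first by rewrite (leq_trans M1) // leq_pmulr // fact_gt0.
  have [x' xx'] := agree_extend i x (ltnW M1) ee'.
  by exists x'; exact: PN.
elim: f => /= [_|s t /andP[sk tk]|n n1 t tk|g IHg gk|g IHg h IHh /andP[gk hk]
              |g IHg h IHh /andP[gk hk]|g IHg h IHh /andP[gk hk]
              |i g IHg /andP[ik gk]|i g IHg /andP[ik gk]].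
- by exists 0, 2.
- pose a (j : 'I_k) := 1 * exponent s j - 1 * exponent t j.
  exists (\max_j `|a j|%N), 2; split=> // e e' [eqs _].
  have E e0 : eval e0 s = eval e0 t <-> lc e0 a = 0.
    rewrite lcB !mulr1z -!eval_exponent //.
    by split=> [->|/eqP]; rewrite ?subrr // subr_eq0 => /eqP.
  by rewrite !E; apply: eqs => j; exact: leq_bigmax.
- exists 0, n; split=> // e e' [_ divs].
  by rewrite !is_nth_powerE ?(ltnW n1) // !(@eval_exponent k).
- have [N [M [M1 gN]]] := IHg gk; exists N, M; split=> // e e' /gN ->.
  by [].
- have [N [M [M1 ghN]]] := join _ _ (IHg gk) (IHh hk).
  by exists N, M; split=> // e e' /ghN [-> ->].
- have [N [M [M1 ghN]]] := join _ _ (IHg gk) (IHh hk).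
  by exists N, M; split=> // e e' /ghN [-> ->].
- have [N [M [M1 ghN]]] := join _ _ (IHg gk) (IHh hk).
  by exists N, M; split=> // e e' /ghN [-> ->].
- have [N [M [M1 gN]]] := bind (Ordinal ik) _ (IHg gk).
  exists N, M; split=> // e e' ee'; split=> ge x.
    by have [x' xx'] := gN e' e (agree_sym ee') x; apply/xx'.
  by have [x' xx'] := gN e e' ee' x; apply/xx'.
- have [N [M [M1 gN]]] := bind (Ordinal ik) _ (IHg gk).
  exists N, M; split=> // e e' ee'; split=> -[x gx].
    by have [x' xx'] := gN e e' ee' x; exists x'; apply/xx'.
  by have [x' xx'] := gN e' e (agree_sym ee') x; exists x'; apply/xx'.
Qed.

(** * From determined properties to quantifier-free formulas *)

Fixpoint term_pow t n := if n is n'.+1 then TMul t (term_pow t n') else TOne.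

Definition term_powz t (c : int) :=
  match c with Posz n => term_pow t n | Negz n => TInv (term_pow t n.+1) end.

Definition lc_term k (a : 'I_k -> int) : term :=
  \big[TMul/TOne]_(j < k) term_powz (TVar j) (a j).

Lemma eval_lc_term k e (a : 'I_k -> int) : eval e (lc_term a) = lc e a.
Proof.
have powE t n : eval e (term_pow t n) = eval e t *+ n.
  by elim: n => //= n IHn; rewrite mulrS -IHn.
rewrite /lc_term (big_morph (eval e) (id1 := 0) (op1 := +%R)) //.
apply: eq_bigr => j _; case: (a j) => n; first exact: powE.
by rewrite -[LHS]/(- eval e (term_pow _ n.+1)) powE.
Qed.

(** One atom at a time: P is equivalent to the disjunction of its traces on the
assignments where the first atom is true and on those where it is false. Such a
trace Q only sees the remaining atoms when it is closed under agreement on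
them. *)
Lemma qf_of_determined (T : eqType) (atom : T -> formula) (s : seq T)
    (P : (nat -> Qpos) -> Prop) :
    (forall x, quantifier_free (atom x)) ->
    (forall e e', {in s, forall x, holds e (atom x) <-> holds e' (atom x)} ->
       P e -> P e') ->
  exists g, quantifier_free g /\ forall e, P e <-> holds e g.
Proof.
move=> qf; elim: s P => [|x s IHs] P Ps.
  (* Without atoms, P is constant. *)
  have [[e0 Pe0]|noP] := pselect (exists e, P e).
    exists (FNot FFalse); split=> // e; split=> [_ []|_].
    by apply: Ps Pe0 => x.
  by exists FFalse; split=> // e; split=> // Pe; apply: noP; exists e.
pose Q (b : Prop) e := exists e', [/\ P e', holds e' (atom x) <-> b &
  {in s, forall y, holds e' (atom y) <-> holds e (atom y)}].
have Qs b : exists g, quantifier_free g /\ forall e, Q b e <-> holds e g.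
  apply: IHs => e1 e2 e12 [e' [Pe' xb e'1]]; exists e'; split=> // y ys.
  by rewrite e'1 // e12.
have [g1 [qf1 Q1]] := Qs True; have [g0 [qf0 Q0]] := Qs False.
exists (FOr (FAnd (atom x) g1) (FAnd (FNot (atom x)) g0)).
split=> [|e]; first by rewrite /= !qf qf1 qf0.
rewrite /= -Q1 -Q0; split=> [Pe|].
  by have [hx|hx] := pselect (holds e (atom x)); [left|right]; split=> //; exists e.
have back b : (holds e (atom x) <-> b) -> Q b e -> P e.
  move=> xb [e' [Pe' xb' e's]]; apply: Ps Pe' => y.
  by rewrite in_cons => /predU1P[->|/e's//]; rewrite xb xb'.
by move=> [[hx]|[hx]]; apply: back.
Qed.

Theorem theorem4p10 (f : formula) :
  exists g : formula, quantifier_free g /\ equivalent f g.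
Proof.
have [k /formula_determined[N [M [M1 fN]]]] := formula_below_exists f.
(* W codes the coefficient vectors in [-N, N], shifted by N; D codes the
   coefficient vectors modulo M. *)
pose W := {ffun 'I_k -> 'I_(2 * N).+1}; pose D := {ffun 'I_k -> 'I_M}.
pose atom (c : W + D) := match c with
  | inl w => FEq (lc_term (fun j => (w j : nat)%:Z - N%:Z)) TOne
  | inr d => FPow M1 (lc_term (fun j => (d j : nat)%:Z)) end.
apply: (@qf_of_determined _ atom (enum {: W + D}) (fun e => holds e f)) => [[]//|].
move=> e e' ats; suff /fN-> : agree k N M e e' by [].
split=> a.
  move=> aN; have := ats (inl [ffun j => inord `|(a j + N%:Z)%R|%N]).
  rewrite mem_enum => /(_ isT) /=; rewrite !eval_lc_term.
  by rewrite !(eq_lc _ (b := a)) // => j;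
    rewrite ffunE inordK; have := aN j; lia.
have M0 : (0 < M)%N by exact: ltnW.
have Mz : M%:Z != 0 by lia.
have am j : (`|(a j %% M%:Z)%Z|%N < M)%N.
  by have := @ltz_pmod (a j) M%:Z M0; have := @modz_ge0 (a j) M%:Z Mz; lia.
have := ats (inr [ffun j => Ordinal (am j)]).
rewrite mem_enum => /(_ isT) /=; rewrite !is_nth_powerE // !eval_lc_term.
have E e0 : divisible M (lc e0 (fun j => ([ffun j => Ordinal (am j)] j : nat)%:Z))
    <-> divisible M (lc e0 a).
  rewrite (eq_lc _ (b := fun j => 1 * a j - M%:Z * (a j %/ M%:Z)%Z)).
    by rewrite lcB mulr1z; apply: divisibleBl; exists (lc e0 (fun j => (a j %/ M%:Z)%Z)).
  move=> j; rewrite ffunE /= gez0_abs ?modz_ge0 //.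
  by have := divz_eq (a j) M%:Z; lia.
by rewrite !E.
Qed.
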